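(* Let $(X,d)$ be a metric space, $I\subseteq\mathbb{R}$ an open interval, $f:I\to(0,\infty)$ continuous and $Y=I\times_f X$. Let $\gamma_n=(\alpha_n,\beta_n)$ ($n\in\mathbb{N}$) and $\gamma=(\alpha,\beta):[a,b]\to Y$ be absolutely continuous curves such that each $\gamma_n$ is future directed causal (respectively each $\gamma_n$ is past directed causal). Suppose $\dot\alpha\neq0$ almost everywhere and $\gamma_n\to\gamma$ pointwise. Then $\gamma$ is causal.
   Context: $Y=I\times X$ with metric $D((t,x),(t',x'))=|t-t'|+d(x,x')$; absolute continuity is with respect to $D$, and for $\gamma=(\alpha,\beta)$ absolutely continuous the metric derivative $v_\beta$ exists a.e. A curve $\gamma=(\alpha,\beta)$ is causal if it is absolutely continuous, $\alpha$ is strictly monotone, and $-\dot\alpha^2+(f\circ\alpha)^2v_\beta^2\le0$ a.e.; it is future (past) directed if $\dot\alpha>0$ ($\dot\alpha<0$) a.e. *)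

(* Defs.v *)
From HB Require Import structures.
From mathcomp Require Import all_boot all_order all_algebra.
From mathcomp Require Import all_classical all_reals all_analysis.

Set Implicit Arguments.
Unset Strict Implicit.
Unset Printing Implicit Defensive.

Import Order.TTheory GRing.Theory Num.Theory.
Import numFieldNormedType.Exports.
Local Open Scope classical_set_scope.
Local Open Scope ring_scope.

Section Defs.
Variable R : realType.

Definition is_metric (X : Type) (d : X -> X -> R) : Prop :=
  [/\ (forall x y, 0 <= d x y),
      (forall x y, d x y = 0 <-> x = y),
      (forall x y, d x y = d y x) &
      (forall x y z, d x z <= d x y + d y z)].

Definition open_itv (l u : \bar R) : set R :=
  [set t | (l < t%:E)%E /\ (t%:E < u)%E].

Definition warped_dist (X : Type) (d : X -> X -> R) (p q : R * X) : R :=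
  `|p.1 - q.1| + d p.2 q.2.

Definition abs_cont_curve (T : Type) (dist : T -> T -> R) (a b : R)
    (g : R -> T) : Prop :=
  forall e : R, 0 < e -> exists2 del : R, 0 < del &
    forall (n : nat) (s t : 'I_n -> R),
      (forall i, a <= s i /\ s i <= t i /\ t i <= b) ->
      (forall i j, i != j -> t i <= s j \/ t j <= s i) ->
      \sum_(i < n) (t i - s i) < del ->
      \sum_(i < n) dist (g (s i)) (g (t i)) < e.

Definition metric_deriv_at (X : Type) (d : X -> X -> R) (beta : R -> X)
    (t v : R) : Prop :=
  (fun h : R => d (beta (t + h)) (beta t) / `|h|) @ (0 : R)^' --> v.

Definition ae_on (a b : R) (P : R -> Prop) : Prop :=
  {ae (@lebesgue_measure R), forall t, `[a, b]%classic t -> P t}.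

Definition strictly_monotone_on (a b : R) (alpha : R -> R) : Prop :=
  (forall s t, a <= s -> s < t -> t <= b -> alpha s < alpha t) \/
  (forall s t, a <= s -> s < t -> t <= b -> alpha t < alpha s).

Definition causal (X : Type) (d : X -> X -> R) (f : R -> R) (a b : R)
    (alpha : R -> R) (beta : R -> X) : Prop :=
  [/\ abs_cont_curve (warped_dist d) a b (fun t => (alpha t, beta t)),
      strictly_monotone_on a b alpha &
      ae_on a b (fun t => derivable alpha t 1 /\
        exists v, metric_deriv_at d beta t v /\
          - (derive1 alpha t) ^+ 2 + (f (alpha t)) ^+ 2 * v ^+ 2 <= 0)].

Definition future_directed_causal (X : Type) (d : X -> X -> R) (f : R -> R)
    (a b : R) (alpha : R -> R) (beta : R -> X) : Prop :=
  causal d f a b alpha beta /\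
  ae_on a b (fun t => derivable alpha t 1 /\ 0 < derive1 alpha t).

Definition past_directed_causal (X : Type) (d : X -> X -> R) (f : R -> R)
    (a b : R) (alpha : R -> R) (beta : R -> X) : Prop :=
  causal d f a b alpha beta /\
  ae_on a b (fun t => derivable alpha t 1 /\ derive1 alpha t < 0).

End Defs.

(* Main.v *)
Require Import Defs.
From HB Require Import structures.
From mathcomp Require Import all_boot all_order all_algebra.
From mathcomp Require Import all_classical all_reals all_analysis.
From mathcomp Require Import measurable_realfun ring lra.
Set Implicit Arguments.
Unset Strict Implicit.
Unset Printing Implicit Defensive.
Import Order.TTheory GRing.Theory Num.Theory.
Import numFieldNormedType.Exports.
Local Open Scope classical_set_scope.
Local Open Scope ring_scope.

(** Each [gamma_n] satisfies [d (beta_n s) (beta_n t) <= (alpha_n t - alpha_n s) / m]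
    whenever [m] is a lower bound of [f] on the values of [alpha_n] over [[s, t]];
    this estimate, unlike the differential inequality, passes to pointwise limits.
    Dividing by [t - s] and letting [m] tend to [f (alpha s)] gives back
    [f (alpha s) * v <= derive1 alpha s] wherever the metric derivative [v] of
    [beta] exists.  It exists almost everywhere because [beta] is dominated by the
    monotone absolutely continuous function [G = alpha / m]: for a dense sequence
    [q_n], the functions [d (beta t) (beta q_n) + G t] are monotone and absolutely
    continuous, hence differentiable a.e. (Radon-Nikodym for their
    Lebesgue-Stieltjes measures, then Lebesgue differentiation), and the supremum
    of the absolute derivatives of [d (beta t) (beta q_n)] is the metric
    derivative.  Strict monotonicity of [alpha] follows from monotonicity of the
    limit and [derive1 alpha != 0] a.e. *)

(** * Real induction and first-order expansions *)

(** The supremum of the points of [[s, t]] where [P] holds satisfies [P] by the left half of the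
    local condition, and the right half would carry [P] beyond it unless it is [t]. *)
Lemma real_induction (R : realType) (P : R -> Prop) (s t : R) :
  s <= t -> P s ->
  (forall c, s <= c <= t -> exists2 eta : R, 0 < eta &
     (forall x, s <= x <= c -> c - x < eta -> P x -> P c) /\
     (forall x, c <= x <= t -> x - c < eta -> P c -> P x)) ->
  P t.
Proof.
move=> st Ps loc.
pose A := [set x | s <= x <= t /\ P x].
have As : A s by split; rewrite ?lexx.
have hsA : has_sup A by split; [exists s | exists t => x [/andP[]]].
have sc : s <= sup A by apply: ub_le_sup => //; case: hsA.
have ct : sup A <= t by apply: ge_sup; [exists s | move=> x [/andP[]]].
have [|eta eta0 [lP rP]] := loc (sup A); first by rewrite sc.
have [x [/andP[sx xt] Px] cx] := sup_adherent eta0 hsA.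
have xc : x <= sup A by apply: ub_le_sup; [case: hsA | split; rewrite ?sx].
have Pc : P (sup A) by apply: lP Px; [rewrite sx | lra].
have [->//|] := eqVneq t (sup A).
move=> tc; have {tc ct}ct : sup A < t by rewrite lt_neqAle eq_sym tc.
pose y := Num.min t (sup A + eta / 2).
have cy : sup A < y by rewrite lt_min ct; lra.
have : y <= sup A.
  apply: ub_le_sup; first by case: hsA.
  split; first by rewrite (le_trans sc (ltW cy)) ge_min lexx.
  apply: rP Pc; first by rewrite (ltW cy) ge_min lexx.
  have yc : y <= sup A + eta / 2 by rewrite ge_min lexx orbT.
  by move: (y) yc => z zc; lra.
by rewrite leNgt cy.
Qed.

(** Multiplying out the difference quotient admits [h = 0] and turns later uses into linear
    arithmetic. *)
Lemma derivable_eps (R : realType) (F : R -> R) (x : R) :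
  derivable F x 1 -> forall e : R, 0 < e -> exists2 eta : R, 0 < eta &
  forall h, `|h| < eta -> `|F (x + h) - F x - derive1 F x * h| <= e * `|h|.
Proof.
move=> /[dup] dF /derivable1P dF1 e e0.
have := dF.
rewrite /derivable => /cvg_ex [l Fl].
have Dl : derive1 F x = l.
  rewrite derive1E; apply: cvg_lim => //.
move/cvgrPdist_le : Fl => /(_ e e0); rewrite near_withinE.
move=> /nbhs_ballP[eta /= eta0 Feta]; exists eta => // h heta.
have [->|h0] := eqVneq h 0; first by rewrite addr0 mulr0 subrr subr0 !normr0 mulr0.
have := Feta h; rewrite /ball /= sub0r normrN => /(_ heta h0).
rewrite [h%:A]mulr1 Dl => le.
have -> : F (x + h) - F x - l * h = - (l - h^-1 *: (F (h + x) - F x)) * h.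
  by rewrite /GRing.scale/= [h + x]addrC; field.
by rewrite normrM normrN ler_wpM2r.
Qed.

Lemma metric_deriv_atP (R : realType) (X : Type) (d : X -> X -> R)
    (beta : R -> X) (x v : R) : is_metric d ->
  metric_deriv_at d beta x v <->
  forall e : R, 0 < e -> exists2 eta : R, 0 < eta &
  forall h, `|h| < eta -> `|d (beta (x + h)) (beta x) - v * `|h| | <= e * `|h|.
Proof.
move=> [d0 dE _ _]; split => [bv e e0|bv].
  move/cvgrPdist_le : bv => /(_ e e0); rewrite near_withinE.
  move=> /nbhs_ballP[eta /= eta0 Feta]; exists eta => // h heta.
  have [->|h0] := eqVneq h 0.
    by rewrite addr0 normr0 !mulr0 subr0 (dE _ _).2// normr0.
  have := Feta h; rewrite /ball /= sub0r normrN => /(_ heta h0).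
  have nh : `|h| != 0 by rewrite normr_eq0.
  have -> : d (beta (x + h)) (beta x) - v * `|h| =
    - (v - d (beta (x + h)) (beta x) / `|h|) * `|h| by field.
  by move=> le; rewrite normrM normrN normr_id ler_wpM2r.
apply/cvgrPdist_le => e e0; rewrite near_withinE.
have [eta eta0 beta_eta] := bv e e0.
apply/nbhs_ballP; exists eta => //= h; rewrite /ball /= sub0r normrN => heta h0.
have nh : 0 < `|h| by rewrite normr_gt0.
rewrite -(ler_pM2r nh) -[X in _ * X]normr_id -normrM.
have -> : (v - d (beta (x + h)) (beta x) / `|h|) * `|h| =
  - (d (beta (x + h)) (beta x) - v * `|h|) by field; rewrite gt_eqF.
by rewrite normrN; exact: beta_eta.
Qed.

(** * Null sets and increment bounds from almost everywhere estimates *)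

(** Outer regularity makes the excess of [U] over a measurable null superset [A] of [N] small;
    adding [A] back costs nothing. *)
Lemma negligible_open_cover (R : realType) (N : set R) (e : R) :
  (@lebesgue_measure R).-negligible N -> 0 < e ->
  exists U, [/\ open U, N `<=` U & (lebesgue_measure U < e%:E)%E].
Proof.
move=> [A [mA A0 NA]] e0.
have A0' : (lebesgue_measure A <= 0)%E.
  by rewrite le_eqVlt; apply/orP; left; apply/eqP; exact: A0.
have [|U [oU AU Ue]] := lebesgue_regularity_outer mA _ e0; first exact: le_lt_trans A0' (ltry _).
exists U; split => //; first exact: subset_trans AU.
apply: le_lt_trans Ue; rewrite -[X in (lebesgue_measure X <= _)%E](setDUK AU).
have mU : measurable U by exact: open_measurable.
apply: le_trans (measureU2 _ _ _) _ => //; first exact: measurableD.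
by rewrite -[leRHS]add0e leeD2r.
Qed.

Lemma ae_onP (R : realType) (a b : R) (P : R -> Prop) :
  ae_on a b P -> exists2 N : set R, (@lebesgue_measure R).-negligible N &
  forall x, a <= x <= b -> ~ N x -> P x.
Proof.
move=> aeP; exists (~` [set t | `[a, b]%classic t -> P t]) => // x xab.
by move=> /contrapT; apply; rewrite /= in_itv.
Qed.

(* Real induction replaces Cousin's lemma: the exceptional null set lies in an
   open [U] of small measure, and the steps taken inside [U] are collected in a
   list of disjoint intervals, whose total increment absolute continuity bounds. *)
Lemma abs_cont_dist_le (R : realType) (T : Type) (dist : T -> T -> R)
    (g : R -> T) (H : R -> R) (s t : R) :
  is_metric dist -> s <= t -> abs_cont_curve dist s t g ->
  (forall x y, s <= x -> x <= y -> y <= t -> H x <= H y) ->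
  ae_on s t (fun x => forall e : R, 0 < e -> exists2 eta : R, 0 < eta &
    forall h, `|h| < eta -> s <= x + h <= t ->
      dist (g (x + h)) (g x) <= `|H (x + h) - H x| + e * `|h|) ->
  dist (g s) (g t) <= H t - H s.
Proof.
move=> [d0 dE dC dT] st acg ndH /ae_onP[N nN goodN].
suff main (e : R) : 0 < e -> dist (g s) (g t) <= H t - H s + e * (t - s) + e.
  apply/ler_addgt0Pr => e e0.
  (* Scaling by [t - s + 1], positive even if [s = t], merges both error terms of [main] into one
     [e]. *)
  have c0 : 0 < t - s + 1 by rewrite ltr_wpDl// subr_ge0.
  apply: le_trans (main (e / (t - s + 1)) _) _; first by rewrite divr_gt0.
  rewrite -addrA lerD2l -[X in _ + X]mulr1 -mulrDr.
  by rewrite divfK ?gt_eqF.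
move=> e0; have [del del0 acdel] := acg _ e0.
have [U [oU NU Udel]] := negligible_open_cover nN del0.
have mU : measurable U by exact: open_measurable.
pose ivl x (L : seq (R * R)) :=
  [/\ forall p, p \in L -> [/\ s <= p.1, p.1 <= p.2 & p.2 <= x],
      pairwise (fun p q => p.2 <= q.1) L &
      ((\sum_(p <- L) (p.2 - p.1))%:E <=
        lebesgue_measure (U `&` `]s, x]))%E].
(* Invariant of the real induction: the distance is paid for by [H], by a slope [e], and by the
   intervals of [L], whose total length is at most the measure of the part of [U] met so far. *)
pose P x := exists L, ivl x L /\
  dist (g s) (g x) <= H x - H s + e * (x - s)
                      + \sum_(p <- L) dist (g p.1) (g p.2).
pose link x y := `]x, y] `<=` U \/
  dist (g x) (g y) <= H y - H x + e * (y - x).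
have stepP x y : s <= x -> x <= y -> y <= t -> link x y -> P x -> P y.
  move=> sx xy yt lxy [L [[Lin Ldis Lsum] Lx]].
  have sxyU : U `&` `]s, y] = (U `&` `]s, x]) `|` (U `&` `]x, y]).
    rewrite -setIUr; congr (_ `&` _).
    by rewrite -itv_bndbnd_setU// bnd_simp.
  have mm : lebesgue_measure (U `&` `]s, y]) =
      (lebesgue_measure (U `&` `]s, x]) + lebesgue_measure (U `&` `]x, y]))%E.
    rewrite sxyU measureU//; [exact: measurableI..|].
    rewrite setIACA setIid -subset0 => z /= [_].
    by rewrite !in_itv/= => -[/andP[_ zx] /andP[xz _]]; move: (lt_le_trans xz zx); rewrite ltxx.
  (* A step inside [U] is appended to [L]; any other step is absorbed by [H] and the slope [e]. *)
  case: lxy => [xyU|dxy].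
    exists (rcons L (x, y)); split; first split.
    - move=> p; rewrite mem_rcons inE => /predU1P[->//|/Lin[? ? px]].
      by split => //; exact: le_trans xy.
    - rewrite pairwise_rcons Ldis andbT; apply/allP => p /Lin[_ _ ?] //.
    - rewrite big_rcons/= mm EFinD leeD// setIidr//.
      rewrite lebesgue_measure_itv/= lte_fin; case: ifPn => [_|]; first by rewrite EFinB.
      by rewrite -leNgt lee_fin subr_le0.
    rewrite big_rcons/=; apply: le_trans (dT _ (g x) _) _.
    have Hxy : H x <= H y by exact: ndH.
    have exy : 0 <= e * (y - x) by rewrite mulr_ge0 ?subr_ge0// ltW.
    lra.
  exists L; split; first split => //.
  - by move=> p /Lin[? ? px]; split => //; exact: le_trans xy.
  - by rewrite mm (le_trans Lsum)// leeDl.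
  apply: le_trans (dT _ (g x) _) _; lra.
have Pt : P t.
  apply: (real_induction st).
    exists [::]; split; last by rewrite big_nil (dE _ _).2//; lra.
    by split => //; rewrite big_nil measure_ge0.
  move=> c /andP[sc ct].
  have [eta eta0 linkc] : exists2 eta : R, 0 < eta &
      (forall x, s <= x -> x <= c -> c - x < eta -> link x c) /\
      (forall x, c <= x -> x <= t -> x - c < eta -> link c x).
    (* Near a point of [U] every short step stays in the open set [U]; at any other point the almost
       everywhere estimate is available. *)
    have [Uc|Uc] := pselect (U c).
      have /nbhs_ballP[eta /= eta0 etaU] : nbhs c U by exact: open_nbhs_nbhs.
      exists eta => //; split=> x x1 x2 x3; left => z /=; rewrite in_itv/= => /andP[? ?];
        apply: etaU; rewrite /ball/= ltr_norml; lra.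
    have [|/NU//|] := goodN c _ _ e e0; first by rewrite sc.
    move=> eta eta0 gc; exists eta => //.
    have gc' x : s <= x -> x <= t -> `|x - c| < eta ->
        dist (g x) (g c) <= `|H x - H c| + e * `|x - c|.
      move=> sx xt xc; have := gc (x - c) xc.
      by rewrite addrCA subrr addr0; apply; rewrite sx.
    split=> x x1 x2 x3; right.
      have := gc' x x1 (le_trans x2 ct).
      have Hxc := ndH _ _ x1 x2 ct.
      by rewrite (distrC x) (distrC (H x)) !ger0_norm ?subr_ge0//; apply.
    have := gc' x (le_trans sc x1) x2.
    have Hxc := ndH _ _ sc x1 x2.
    by rewrite dC !ger0_norm ?subr_ge0//; apply.
  exists eta => //; split => x /andP[x1 x2] x3.
  - by apply: stepP => //; apply: linkc.1.
  - by apply: stepP => //; apply: linkc.2.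
have [L [[Lin Ldis Lsum] Lx]] := Pt.
apply: (le_trans Lx); rewrite lerD2l.
have nthin (i : 'I_(size L)) : nth (0, 0) L i \in L by rewrite mem_nth.
(* The list is read as a finite family of disjoint intervals of total length below [del], so its
   increments sum to less than [e]. *)
have /= := acdel (size L) (fun i => (nth (0, 0) L i).1) (fun i => (nth (0, 0) L i).2).
rewrite (big_nth (0, 0)) big_mkord => acL; apply/ltW/acL.
- by move=> i; have [? ? ?] := Lin _ (nthin i).
- move=> i j ij.
  move/(pairwiseP (0, 0)) : Ldis => Ldis.
  have [ltij|ltji|/val_inj eij] := ltngtP i j.
  - by left; apply: Ldis => //; rewrite inE.
  - by right; apply: Ldis => //; rewrite inE.
  - by rewrite eij eqxx in ij.
rewrite -lte_fin; apply: le_lt_trans Udel.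
rewrite (big_nth (0, 0)) big_mkord in Lsum.
apply: (le_trans Lsum); apply: le_measure; rewrite ?inE//.
exact: measurableI.
Qed.

(** * Monotone absolutely continuous functions as integrals *)

Definition real_dist (R : realType) (x y : R) : R := `|x - y|.

Lemma real_dist_metric (R : realType) : is_metric (@real_dist R).
Proof.
split=> [x y|x y|x y|x y z]; rewrite /real_dist.
- exact: normr_ge0.
- by split=> [/normr0_eq0/subr0_eq//|->]; rewrite subrr normr0.
- exact: distrC.
- exact: ler_distD.
Qed.

Lemma abs_cont_continuous (R : realType) (F : R -> R) :
  (forall a b, abs_cont_curve (@real_dist R) a b F) -> continuous F.
Proof.
move=> acF x; apply/cvgrPdist_lt => e e0.
have [del del0 acx] := acF (x - 1) (x + 1) e e0.
apply/nbhs_ballP; exists (Num.min del 1); first by rewrite /= lt_min del0 ltr01.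
move=> y; rewrite /ball/= lt_min => /andP[xy xy1].
have := acx 1%N (fun=> Num.min x y) (fun=> Num.max x y).
rewrite !big_ord1 /real_dist; move: xy xy1.
case: (leP x y) => [le|/ltW le]; rewrite ?(distrC (F y)) !ltr_norml => /andP[? ?] /andP[? ?] acy.
- apply: acy.
  + by move=> _; split; lra.
  + by move=> i j; rewrite !ord1.
  + lra.
- apply: acy.
  + by move=> _; split; lra.
  + by move=> i j; rewrite !ord1.
  + lra.
Qed.

Lemma Rintegral_ae_derivable (R : realType) (m : R -> R) (a : R) :
  lebesgue_measure.-integrable setT (EFin \o m) ->
  let M x := \int[lebesgue_measure]_(t in `]a, x]) m t in
  {ae lebesgue_measure, forall x, a < x -> derivable M x 1 /\ derive1 M x = m x}.
Proof.
have Fae := ae_filter_ringOfSetsType (@lebesgue_measure R).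
move=> intm M.
have locm : locally_integrable setT m.
  have -> : m = m \_ setT by apply/funext => z; rewrite patchE in_setT.
  exact: integrable_locally.
have intA z : lebesgue_measure.-integrable [set` Interval (BRight a) (BRight z)] (EFin \o m).
  exact: integrableS intm.
have := FTC1 intA locm; apply: filterS => // x /= + ax; exact.
Qed.

Section stieltjes_dominated.
Context (R : realType) (F : R -> R).
Hypothesis ndF : {homo F : x y / x <= y}.
Hypothesis acF : forall a b, abs_cont_curve (@real_dist R) a b F.

Let rcF : right_continuous F.
Proof. exact/right_continuousW/abs_cont_continuous. Qed.

HB.instance Definition _ := isCumulative.Build R _ R F ndF rcF.

Let nu := lebesgue_stieltjes_measure F.

Let nuE u v : u <= v -> nu `]u, v] = (F v - F u)%:E.
Proof.
move=> uv; rewrite /nu /lebesgue_stieltjes_measure /measure_extension.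
rewrite measurable_mu_extE/=; last exact: is_ocitv.
by rewrite wlength_itv_bnd// EFinB.
Qed.

(** The half-open intervals from [- n] to [n] exhaust the line, and each has mass [F n - F (- n)],
    at most [2 * B]. *)
Lemma stieltjes_finite (B : R) : (forall x, `|F x| <= B) -> (nu setT <= (2 * B)%:E)%E.
Proof.
move=> FB; rewrite -(bigcup_itvT false false).
pose I n : set R := `]- (n%:R), n%:R]%classic.
have nuI : (nu \o I) n @[n --> \oo] --> nu (\bigcup_n I n).
  apply: nondecreasing_cvg_mu; rewrite /I//; first exact: bigcup_measurable.
  by move=> *; apply/subsetPset/subset_itv; rewrite leBSide/= ?lerN2 ler_nat.
rewrite -(cvg_lim _ nuI)//; apply: lime_le; first by apply/cvg_ex; eexists; exact: nuI.
apply: nearW => n; rewrite /= nuE ?ge0_cp// lee_fin.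
by have := FB n%:R; have := FB (- n%:R); rewrite !ler_norml => /andP[? ?] /andP[? ?]; lra.
Qed.

(** A null set lies in an open set of small measure; absolute continuity bounds the increments of
    [F] over any finitely many of its components, and countable subadditivity passes to all of
    them. *)
Lemma stieltjes_dominated : nu `<< lebesgue_measure.
Proof.
apply/null_content_dominatesP => A mA A0.
(* Absolute continuity is available on compact intervals only, so the null set is cut into bounded
   pieces. *)
pose J (N : R) : set R := `]- N, N[%classic.
have mJ N : measurable (J N) by exact: measurable_itv.
suff nuAN (n : nat) : nu (A `&` J n%:R) = 0%E.
  have -> : A = \bigcup_n (A `&` J n%:R).
    rewrite -setI_bigcupr; apply/esym/setIidl => x _.
    exists (Num.bound x) => //; rewrite /J/= in_itv/=.
    by rewrite ltrNl; apply/andP; split; [exact: unstable.ltrNbound | exact: unstable.ltr_bound].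
  apply/negligibleP.
    by apply: bigcup_measurable => k _; apply: measurableI; [exact: mA | exact: mJ].
  apply: negligible_bigcup => k; exists (A `&` J k%:R); split => //.
  apply: measurableI; [exact: mA | exact: mJ].
apply/eqP; rewrite eq_le measure_ge0 andbT.
apply/lee_addgt0Pr => e e0; rewrite add0e.
set N : R := n%:R.
have [del del0 acN] := acF (- N) N e0.
have [|U [oU AU Udel]] := @negligible_open_cover _ A del _ del0.
  by exists A; split.
pose V := U `&` J N.
have oV : open V by apply: openI => //; exact: itv_open.
have mV : measurable V by exact: open_measurable.
pose I := open_disjoint_itv oV.
have mI k : measurable (I k).
  by apply: open_measurable; exact: open_disjoint_itv_open.
have IV : V = \bigcup_k I k by exact: open_disjoint_itv_bigcup.
have IN k x : I k x -> - N < x < N.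
  move=> Ix; have [_] : V x by rewrite IV; exists k.
  by rewrite /J /= in_itv.
have N0 : - N <= N by rewrite ge0_cp.
(* Empty components are collapsed at [N], not at the junk value [inf set0 = 0],
   which could lie inside another component. *)
pose u k := if I k == set0 then N else inf (I k).
pose v k := if I k == set0 then N else sup (I k).
have lbI k : lbound (I k) (- N) by move=> x /IN/andP[/ltW].
have ubI k : ubound (I k) N by move=> x /IN/andP[_ /ltW].
have uvin k : [/\ - N <= u k, u k <= v k & v k <= N].
  rewrite /u /v; case: eqP => [_|/eqP/set0P[x Ix]]; first by split.
  split.
  - by apply: lb_le_inf => //; exists x.
  - apply: (@le_trans _ _ x); first by apply: ge_inf => //; exists (- N).
    by apply: ub_le_sup => //; exists N.
  - by apply: ge_sup => //; exists x.
have subI k : `]u k, v k[ `<=` I k.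
  move=> x; rewrite /u /v /= in_itv/=; case: eqP => [_|/eqP/set0P[z Iz]]/andP[ux xv].
    by have := lt_trans ux xv; rewrite ltxx.
  have [y Iy yx] := inf_lt (ex_intro _ z Iz) ux.
  have [y' Iy' yx'] := sup_gt (ex_intro _ z Iz) xv.
  apply: (open_disjoint_itv_is_interval (i := k) Iy Iy').
  by rewrite (ltW yx) (ltW yx').
(* Points of an open component lie strictly above its infimum, so the interval may stay open at
   [u k]; in this shape its [nu]-mass is [F (v k) - F (u k)]. *)
have Isub k : I k `<=` `]u k, v k].
  move=> x Ix; rewrite /u /v /= in_itv/=; case: eqP => [I0|_]; first by rewrite I0 in Ix.
  apply/andP; split; last by apply: ub_le_sup => //; exists N.
  have : nbhs x (I k) by apply: open_nbhs_nbhs; split => //; exact: open_disjoint_itv_open.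
  move=> /nbhs_ballP[r /= r0 rI].
  have : I k (x - r / 2) by apply: rI; rewrite /ball/= opprB addrC subrK gtr0_norm; lra.
  move=> /(ge_inf _) => /(_ (ex_intro _ (- N) (lbI k))); lra.
have uvN k : u k < v k \/ u k = N.
  have [I0|/set0P[x /Isub]] := eqVneq (I k) set0.
    by right; rewrite /u I0 eqxx.
  by rewrite /= in_itv/= => /andP[ux xv]; left; exact: lt_le_trans xv.
have AI : A `&` J N `<=` \bigcup_k I k.
  by rewrite -IV; exact: setSI.
have mAn : measurable (A `&` J N) by apply: measurableI; [exact: mA | exact: mJ].
apply: le_trans; first exact: (@measure_sigma_subadditive _ _ _ nu _ _ mI mAn AI).
apply: lime_le; first exact: is_cvg_nneseries.
apply: nearW => m; rewrite big_mkord.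
apply: (@le_trans _ _ (\sum_(k < m) (F (v k) - F (u k))%:E)%E).
  apply: lee_sum => k _; have [_ uv _] := uvin k.
  by rewrite -nuE//; apply: le_measure; rewrite ?inE;
    [exact: mI | exact: measurable_itv | exact: Isub].
rewrite sumEFin lee_fin; apply: le_trans (ltW (acN m (fun k => u k) (fun k => v k) _ _ _)).
- apply: ler_sum => k _; rewrite /real_dist distrC.
  exact: ler_norm.
- by move=> i; have [? ? ?] := uvin i.
- move=> i j ij; have [vu|uv] := leP (v i) (u j); first by left.
  have [vu'|uv'] := leP (v j) (u i); first by right.
  exfalso.
  (* Two overlapping intervals share the midpoint of their intersection, which contradicts the
     disjointness of the components. *)
  have [z zi zj] : exists2 z, `]u i, v i[%classic z & `]u j, v j[%classic z.
    exists ((Num.max (u i) (u j) + Num.min (v i) (v j)) / 2);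
    rewrite /= in_itv/=; have [_ _ ?] := uvin i; have [_ _ ?] := uvin j;
    have [?|?] := uvN i; have [?|?] := uvN j;
    by case: (leP (u i) (u j)) => ?; case: (leP (v i) (v j)) => ?;
      apply/andP; split; lra.
  have tI : trivIset setT I by exact: open_disjoint_itv_trivIset.
  have /val_inj eij : i = j :> nat.
    by apply: tI => //; exists z; split; [exact: subI | exact: subI].
  by rewrite eij eqxx in ij.
rewrite -lte_fin; apply: le_lt_trans Udel.
apply: (@le_trans _ _ (lebesgue_measure (\big[setU/set0]_(k < m) I k))).
  rewrite measure_bigsetU//; last exact: open_disjoint_itv_trivIset.
  rewrite -sumEFin; apply: lee_sum => k _; have [_ uv _] := uvin k.
  apply: (@le_trans _ _ (lebesgue_measure `]u k, v k[%classic)).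
    rewrite lebesgue_measure_itv/= lte_fin; case: ifPn => [_|]; first by rewrite EFinB.
    by rewrite -leNgt lee_fin subr_le0.
  by apply: le_measure; rewrite ?inE;
    [exact: measurable_itv | exact: mI | exact: subI].
apply: le_measure; rewrite ?inE//.
- by apply: bigsetU_measurable => k _; exact: mI.
- exact: open_measurable.
- apply: (@subset_trans _ V); last by move=> x [].
  by rewrite IV; exact: bigsetU_bigcup.
Qed.

(** By Radon-Nikodym the Stieltjes measure of [F] has a density [g], so to the right of [a] the
    function [F] is a constant plus an integral of [g], and Lebesgue differentiation applies.
    Boundedness of [F] makes the measure finite and [g] integrable. *)
Lemma abs_cont_density (B : R) : (forall x, `|F x| <= B) ->
  exists g : R -> R, [/\ forall x, 0 <= g x,
    lebesgue_measure.-integrable setT (EFin \o g) &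
    forall a, {ae lebesgue_measure, forall x, a < x ->
      derivable F x 1 /\ derive1 F x = g x}].
Proof.
move=> FB; have finnu : fin_num_fun nu.
  by apply: lty_fin_num_fun; apply: le_lt_trans (stieltjes_finite FB) (ltry _).
pose nuf : {finite_measure set _ -> \bar R} :=
  HB.pack (lebesgue_stieltjes_measure F)
    (Measure_isFinite.Build _ _ _ (lebesgue_stieltjes_measure F) finnu).
have [f [f0 ffin fint fE]] :=
  @radon_nikodym_sigma_finite _ _ _ lebesgue_measure nuf stieltjes_dominated.
pose g := fine \o f.
have gf : EFin \o g = f by apply/funext => x; rewrite /= fineK.
exists g; split; [by move=> x; rewrite /g /= fine_ge0|by rewrite gf|move=> a].
have intg : lebesgue_measure.-integrable setT (EFin \o g) by rewrite gf.
have := Rintegral_ae_derivable a intg.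
apply: filterS; first exact: (ae_filter_ringOfSetsType lebesgue_measure).
move=> x /= gx ax.
have [dG Gx] := gx ax.
pose G z := (F a + \int[lebesgue_measure]_(t in `]a, z]) g t)%R.
have FG : {near x, F =1 G}.
  near=> z.
  have az : a <= z by apply/ltW; near: z; exact: lt_nbhsr.
  rewrite /G /Rintegral.
  have -> : (\int[lebesgue_measure]_(t in `]a, z]) (EFin \o g) t)%E = nu `]a, z].
    by rewrite [in LHS]gf -fE.
  by rewrite nuE//= addrC subrK.
have aG : {near x, G =1 F} by apply: filterS FG => z ->.
have derG : is_derive x 1 G (g x).
  have -> : G = cst (F a) +
      (fun z => \int[lebesgue_measure]_(t in `]a, z]) g t)%R.
    by [].
  rewrite -[X in is_derive _ _ _ X]add0r; apply: is_deriveD.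
  by apply: DeriveDef => //; rewrite -derive1E.
have := near_eq_is_derive aG derG.
by move=> [dF DF]; split => //; rewrite derive1E.
Unshelve. all: by end_near.
Qed.
End stieltjes_dominated.

(** * Almost everywhere existence of the metric derivative *)

Lemma abs_cont_curve_dominated (R : realType) (X Y : Type) (dX : X -> X -> R)
    (dY : Y -> Y -> R) (p : R -> X) (q : R -> Y) (c a b : R) : 0 <= c ->
  (forall s t, a <= s -> s <= t -> t <= b -> dY (q s) (q t) <= c * dX (p s) (p t)) ->
  abs_cont_curve dX a b p -> abs_cont_curve dY a b q.
Proof.
move=> c0 qp acp e e0; have c1 : 0 < c + 1 by rewrite ltr_wpDl.
have [del del0 acd] := acp (e / (c + 1)) (divr_gt0 e0 c1).
exists del => // n s t st dst sumst.
have := acd n s t st dst sumst; rewrite ltr_pdivlMr// => le.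
apply: (@le_lt_trans _ _ (c * \sum_(i < n) dX (p (s i)) (p (t i)))).
  by rewrite mulr_sumr; apply: ler_sum => i _; have [? [? ?]] := st i; exact: qp.
have [S0|S0] := leP 0 (\sum_(i < n) dX (p (s i)) (p (t i))).
  by apply: le_lt_trans le; rewrite mulrC ler_wpM2l// lerDl.
by apply: le_lt_trans e0; rewrite mulr_ge0_le0// ltW.
Qed.

(** Codes that decode to no rational give [0], which is harmless as only the density of the range
    matters. *)
Definition rat_seq (R : realType) (n : nat) : R := ratr (odflt 0 (unpickle n)).

Lemma rat_seq_dense (R : realType) (x y : R) : x < y ->
  exists n, x < rat_seq R n < y.
Proof.
move=> /rat_in_itvoo[r]; rewrite in_itv/= => xry.
by exists (pickle r); rewrite /rat_seq pickleK.
Qed.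

Lemma Rintegral_nondecreasing (R : realType) (m : R -> R) (a x y : R) :
  (forall z, 0 <= m z) -> lebesgue_measure.-integrable setT (EFin \o m) ->
  x <= y ->
  \int[lebesgue_measure]_(t in `]a, x]) m t <=
  \int[lebesgue_measure]_(t in `]a, y]) m t.
Proof.
move=> m0 intm xy; rewrite /Rintegral.
have intA z : lebesgue_measure.-integrable `]a, z] (EFin \o m) by exact: integrableS intm.
apply: fine_le; [exact: integrable_fin_num..|].
apply: ge0_subset_integral => //=.
- exact: measurable_int (intA y).
- by move=> z _; rewrite lee_fin.
- by apply: subset_itvl; rewrite bnd_simp.
Qed.

Section metric_derivative.
Context (R : realType) (X : Type) (d : X -> X -> R) (beta : R -> X) (G : R -> R).
Hypothesis dmetric : is_metric d.
Hypothesis ndG : {homo G : x y / x <= y}.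
Hypothesis acG : forall a b, abs_cont_curve (@real_dist R) a b G.
Variable B : R.
Hypothesis bdG : forall x, `|G x| <= B.
Hypothesis betaG : forall s t, s <= t -> d (beta s) (beta t) <= G t - G s.

Let phi n t := d (beta t) (beta (rat_seq R n)).

Let d0 x y : 0 <= d x y. Proof. by case: dmetric. Qed.

Let dC x y : d x y = d y x. Proof. by case: dmetric. Qed.
Let dT x y z : d x z <= d x y + d y z. Proof. by case: dmetric. Qed.

Let betaG_abs s t : d (beta s) (beta t) <= `|G s - G t|.
Proof.
have [st|/ltW ts] := leP s t.
  by rewrite distrC (le_trans (betaG st))// ler_norm.
by rewrite dC (le_trans (betaG ts))// ler_norm.
Qed.

Let phi_dist n s t : `|phi n s - phi n t| <= d (beta s) (beta t).
Proof.
rewrite ler_norml /phi lerBrDl lerBlDr.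
have := dT (beta t) (beta s) (beta (rat_seq R n)).
have := dT (beta s) (beta t) (beta (rat_seq R n)).
by rewrite (dC (beta t) (beta s)) => ? ?; apply/andP; split; lra.
Qed.

(** Adding [G] compensates any decrease of [phi n], whose increments are bounded by those of [G];
    the sum is then monotone and absolutely continuous. *)
Let phi_density n : exists g : R -> R, [/\ forall x, 0 <= g x,
    lebesgue_measure.-integrable setT (EFin \o g) &
    forall a, {ae lebesgue_measure, forall x, a < x ->
      derivable (phi n \+ G) x 1 /\ derive1 (phi n \+ G) x = g x}].
Proof.
(* [phi n] contributes [B + B], being at most a difference of two values of [G]. *)
apply: (@abs_cont_density _ _ _ _ (B + B + B)).
- move=> s t st /=; have := betaG st; have := phi_dist n s t.
  by rewrite ler_norml => /andP[? ?] ?; lra.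
- move=> a b; apply: (@abs_cont_curve_dominated _ _ _ (@real_dist R) _ G _ 2) => // s t _ st _.
  rewrite /real_dist /=.
  have := betaG_abs s t; have := phi_dist n s t.
  have : phi n s + G s - (phi n t + G t) = (phi n s - phi n t) + (G s - G t) by ring.
  move=> -> le1 le2; apply: (le_trans (ler_normD _ _)); lra.
- move=> x /=; apply: (le_trans (ler_normD _ _)); rewrite lerD// /phi ger0_norm//.
  by apply: (le_trans (betaG_abs _ _)); apply: (le_trans (ler_normB _ _)); rewrite lerD.
Qed.

Let G_density : exists g : R -> R, [/\ forall x, 0 <= g x,
    lebesgue_measure.-integrable setT (EFin \o g) &
    forall a, {ae lebesgue_measure, forall x, a < x ->
      derivable G x 1 /\ derive1 G x = g x}].
Proof. exact: (@abs_cont_density _ _ ndG acG B). Qed.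

(** Integrating the supremum [m] of the absolute derivatives of the [phi n] gives the upper bound
    [M t - M s] on distances, and a single near-optimal [phi n] gives the matching lower bound at
    each good point; the metric derivative there is [m]. *)
Lemma metric_deriv_ae (a : R) : {ae lebesgue_measure, forall x, a < x ->
  exists v, metric_deriv_at d beta x v}.
Proof.
have /choice[gn gnP] := phi_density.
have [g [g0 intg dG]] := G_density.
(* Almost everywhere [`|gn n x - g x| <= g x]; truncating by [g] on the
   remaining null set keeps the supremum [m] finite and integrable. *)
pose h n x := Num.min `|gn n x - g x| (g x).
have h0 n x : 0 <= h n x by rewrite le_min normr_ge0 g0.
have hub x : has_ubound (range (h ^~ x)).
  by exists (g x) => _ [n _ <-]; rewrite ge_min lexx orbT.
pose m x := sups (h ^~ x) 0%N.
have hm n x : h n x <= m x.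
  rewrite /m /sups; apply: ub_le_sup; last by exists n.
  have [y hy] := hub x; exists y => _ [k _ <-]; apply: hy; by exists k.
have m0 x : 0 <= m x by exact: le_trans (h0 0%N x) (hm 0%N x).
have mg x : m x <= g x.
  apply: ge_sup; first by exists (h 0%N x); exists 0%N.
  by move=> _ [k _ <-]; rewrite ge_min lexx orbT.
have mh x (e : R) : 0 < e -> exists n, m x - e < h n x.
  move=> e0; have [|_ [n _ <-] mn] := @sup_adherent _ (sdrop (h ^~ x) 0%N) e e0.
    split; first by exists (h 0%N x); exists 0%N.
    by have [y hy] := hub x; exists y => _ [k _ <-]; apply: hy; exists k.
  by exists n.
have mesg : measurable_fun setT g by apply/measurable_EFinP; exact: measurable_int intg.
have mesgn n : measurable_fun setT (gn n).
  by have [_ intgn _] := gnP n; apply/measurable_EFinP; exact: measurable_int intgn.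
have mesm : measurable_fun setT m.
  apply: measurable_fun_sups => // n; apply: measurable_minr => //.
  apply: measurableT_comp => //; exact: measurable_funB.
have intm : lebesgue_measure.-integrable setT (EFin \o m).
  apply: le_integrable intg => //; first exact/measurable_EFinP.
  by move=> x _ /=; rewrite lee_fin !ger0_norm.
pose M x := \int[lebesgue_measure]_(t in `]a, x]) m t.
pose good x := [/\ derivable G x 1 /\ derive1 G x = g x,
  forall n, derivable (phi n \+ G) x 1 /\ derive1 (phi n \+ G) x = gn n x &
  derivable M x 1 /\ derive1 M x = m x].
have aegood : {ae lebesgue_measure, forall x, a < x -> good x}.
  have Fae := ae_filter_ringOfSetsType (@lebesgue_measure R).
  have := Rintegral_ae_derivable a intm; move: (dG a).
  have : {ae lebesgue_measure, forall x n, a < x ->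
      derivable (phi n \+ G) x 1 /\ derive1 (phi n \+ G) x = gn n x}.
    by apply/ae_foralln => n; have [_ _] := gnP n; exact.
  by apply: filterS3 => x gnx Gx Mx ax; split; [exact: Gx|move=> n; exact: gnx|exact: Mx].
have goodG x (e : R) : good x -> 0 < e -> exists2 eta : R, 0 < eta & forall k, `|k| < eta ->
    `|G (x + k) - G x - g x * k| <= e * `|k|.
  by move=> [[dGx <-] _ _]; exact: derivable_eps.
have goodM x (e : R) : good x -> 0 < e -> exists2 eta : R, 0 < eta & forall k, `|k| < eta ->
    `|M (x + k) - M x - m x * k| <= e * `|k|.
  by move=> [_ _ [dMx <-]]; exact: derivable_eps.
have goodphi x n (e : R) : good x -> 0 < e -> exists2 eta : R, 0 < eta & forall k, `|k| < eta ->
    `|phi n (x + k) - phi n x - (gn n x - g x) * k| <= e * `|k|.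
  move=> gx e0; have e2 : 0 < e / 2 by rewrite divr_gt0.
  have [eta1 eta10 G1] := goodG x _ gx e2.
  have [_ /(_ n)[dphi phix] _] := gx.
  have [eta2 eta20 G2] := derivable_eps dphi e2.
  exists (Num.min eta1 eta2); first by rewrite lt_min eta10.
  move=> k; rewrite lt_min => /andP[/G1 + /G2]; rewrite phix /=.
  rewrite mulrBl.
  by rewrite !ler_norml => /andP[? ?] /andP[? ?]; apply/andP; split; lra.
(* Domination of the increments by those of [G] makes the truncation in [h] inactive at good
   points. *)
have goodh x n : good x -> `|gn n x - g x| <= m x.
  move=> gx; apply: le_trans (hm n x); rewrite le_min lexx/=.
  apply/ler_addgt0Pr => e e0; have e2 : 0 < e / 2 by rewrite divr_gt0.
  have [eta1 eta10 G1] := goodG x _ gx e2.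
  have [eta2 eta20 G2] := goodphi x n _ gx e2.
  pose k := Num.min eta1 eta2 / 2.
  have k0 : 0 < k by rewrite divr_gt0// lt_min eta10.
  have : `|k| < Num.min eta1 eta2.
    by rewrite gtr0_norm// /k ltr_pdivrMr// ltr_pMr ?ltr1n// lt_min eta10.
  rewrite lt_min => /andP[/G1 G1k /G2 G2k].
  have le1 := phi_dist n (x + k) x; have := betaG_abs (x + k) x.
  have xk : x <= x + k by rewrite lerDl ltW.
  rewrite (@ger0_norm _ (G _ - G _)) ?subr_ge0 ?ndG// => /(le_trans le1) {}le1.
  rewrite -(ler_pM2r k0) -{1}(gtr0_norm k0) -normrM.
  move: le1 G1k G2k; rewrite (gtr0_norm k0) !ler_norml.
  by move=> /andP[? ?] /andP[? ?] /andP[? ?]; apply/andP; split; lra.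
(* The derivative bound makes the increments of [M] dominate those of every [phi n]; taking
   [rat_seq R n] close to [s] makes [phi n s] small and [phi n t] close to [d (beta s) (beta t)]. *)
have betaM s t : a < s -> s <= t -> d (beta s) (beta t) <= M t - M s.
  move=> as_ st; have phiM n : `|phi n s - phi n t| <= M t - M s.
    apply: (@abs_cont_dist_le R R (@real_dist R) (phi n)) => //.
    - exact: real_dist_metric.
    - apply: (@abs_cont_curve_dominated _ _ _ (@real_dist R) _ G _ 1) => // u v _ uv _.
      by rewrite mul1r; exact: le_trans (phi_dist n u v) (betaG_abs u v).
    - by move=> u v _ uv _; exact: Rintegral_nondecreasing.
    - have Fae := ae_filter_ringOfSetsType (@lebesgue_measure R).
      apply: filterS aegood => x gx /=; rewrite in_itv/= => /andP[sx xt] e e0.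
      have {}gx := gx (lt_le_trans as_ sx).
      have e2 : 0 < e / 2 by rewrite divr_gt0.
      have [eta1 eta10 M1] := goodM x _ gx e2.
      have [eta2 eta20 G2] := goodphi x n _ gx e2.
      exists (Num.min eta1 eta2); first by rewrite lt_min eta10.
      move=> k; rewrite lt_min => /andP[/M1 le1 /G2 le2] _.
      rewrite /real_dist.
      have le3 : `|phi n (x + k) - phi n x| <= `|gn n x - g x| * `|k| + e / 2 * `|k|.
        rewrite -normrM -lerBlDl; apply: le_trans le2; exact: lerB_dist.
      have le4 : m x * `|k| - e / 2 * `|k| <= `|M (x + k) - M x|.
        rewrite lerBlDr -lerBlDl -{1}(ger0_norm (m0 x)) -normrM.
        by apply: le_trans le1; rewrite [leRHS]distrC; exact: lerB_dist.
      have := ler_wpM2r (normr_ge0 k) (goodh x n gx); lra.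
  apply/ler_addgt0Pr => e e0; have e4 : 0 < e / 4 by rewrite divr_gt0.
  have /(_ s)/cvgrPdist_lt/(_ _ e4)/nbhs_ballP[r /= r0 Gr] := abs_cont_continuous acG.
  have [|n /andP[sn nr]] := @rat_seq_dense R s (s + r); first by rewrite ltrDl.
  have := Gr (rat_seq R n); rewrite /ball/= ltr_norml => /(_ _)/ltW Gsr.
  have : d (beta s) (beta (rat_seq R n)) <= e / 4.
    by apply: le_trans (betaG_abs _ _) _; apply: Gsr; apply/andP; split; lra.
  have := phiM n; have := dT (beta s) (beta (rat_seq R n)) (beta t).
  rewrite /phi (dC (beta (rat_seq R n)) (beta t)) ler_norml => ? /andP[? ?] ?; lra.
have Fae := ae_filter_ringOfSetsType (@lebesgue_measure R).
apply: filterS aegood => x + ax => /(_ ax) gx; exists (m x).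
apply/(metric_deriv_atP _ _ _ dmetric) => e e0.
have e2 : 0 < e / 2 by rewrite divr_gt0.
have [n mn] := mh x _ e2.
have [eta1 eta10 M1] := goodM x _ gx e2.
have [eta2 eta20 G2] := goodphi x n _ gx e2.
(* The bound [x - a] keeps [x + k] above [a], where [betaM] applies. *)
exists (Num.min (Num.min eta1 eta2) (x - a)); first by rewrite !lt_min eta10 eta20 subr_gt0.
move=> k; rewrite !lt_min => /andP[/andP[/M1 le1 /G2 le2] kxa].
have axk : a < x + k by move: kxa; rewrite ltr_norml => /andP[? ?]; lra.
have le3 : `|phi n (x + k) - phi n x| >= `|gn n x - g x| * `|k| - e / 2 * `|k|.
  rewrite lerBlDr -lerBlDl -normrM.
  by apply: le_trans le2; rewrite [leRHS]distrC; exact: lerB_dist.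
have le4 : `|M (x + k) - M x| <= m x * `|k| + e / 2 * `|k|.
  rewrite -{1}(ger0_norm (m0 x)) -normrM -lerBlDl.
  by apply: le_trans le1; exact: lerB_dist.
have le5 : d (beta (x + k)) (beta x) <= `|M (x + k) - M x|.
  have [xk|/ltW xk] := leP x (x + k).
    by rewrite dC (le_trans (betaM _ _ ax xk))// ler_norm.
  by rewrite (le_trans (betaM _ _ axk xk))// distrC ler_norm.
have le6 := phi_dist n (x + k) x.
have hle : h n x <= `|gn n x - g x| by rewrite ge_min lexx.
have le7 : (m x - e / 2) * `|k| <= `|gn n x - g x| * `|k|.
  by rewrite ler_wpM2r// (le_trans (ltW mn)).
by rewrite ler_norml; apply/andP; split; lra.
Qed.
End metric_derivative.

(** * Restriction to subintervals and extension by clamping *)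

Lemma negligible_itv_exists (R : realType) (N : set R) (s t : R) :
  (@lebesgue_measure R).-negligible N -> s < t -> exists2 x, s < x < t & ~ N x.
Proof.
move=> nN st; apply: contrapT => nex.
have : (@lebesgue_measure R).-negligible `]s, t[.
  apply: negligibleS nN => x; rewrite /= in_itv/= => sxt.
  by apply: contrapT => Nx; apply: nex; exists x.
move=> /negligibleP => /(_ (measurable_itv _)).
have : lebesgue_measure (`]s, t[%classic : set R) = (t - s)%:E.
  by rewrite lebesgue_measure_itv/= lte_fin st EFinB.
by move=> + H; move: H => /[swap]; rewrite /= => -> [] /eqP; rewrite subr_eq0 gt_eqF.
Qed.

Lemma abs_cont_curveS (R : realType) (T : Type) (dist : T -> T -> R)
    (a b s t : R) (g : R -> T) : a <= s -> t <= b ->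
  abs_cont_curve dist a b g -> abs_cont_curve dist s t g.
Proof.
move=> as_ tb acg e /acg[del del0 acd]; exists del => // n u v uv; apply: acd => i.
by have [? [? ?]] := uv i; split; [exact: le_trans as_ _ | split => //; exact: le_trans tb].
Qed.

Lemma ae_onS (R : realType) (a b s t : R) (P : R -> Prop) :
  a <= s -> t <= b -> ae_on a b P -> ae_on s t P.
Proof.
move=> as_ tb; have Fae := ae_filter_ringOfSetsType (@lebesgue_measure R).
rewrite /ae_on => aeP; apply: filterS aeP => x /=; rewrite !in_itv/= => Px /andP[sx xt]; apply: Px.
by rewrite (le_trans as_ sx) (le_trans xt tb).
Qed.

(** For [a <= b], precomposing with this 1-Lipschitz retraction extends a curve on [[a, b]] to the
    whole line and preserves absolute continuity. *)
Definition clamp (R : realType) (a b t : R) : R := Num.max a (Num.min b t).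

Section clamp.
Context (R : realType) (a b : R).
Hypothesis ab : a <= b.

Lemma clamp_in t : a <= clamp a b t <= b.
Proof. by rewrite /clamp le_max lexx ge_max ab ge_min lexx. Qed.

Lemma clamp_id t : a <= t <= b -> clamp a b t = t.
Proof. by move=> /andP[at_ tb]; rewrite /clamp min_r// max_r. Qed.

Lemma clamp_le s t : s <= t ->
  clamp a b s <= clamp a b t /\ clamp a b t - clamp a b s <= t - s.
Proof.
rewrite /clamp => st.
by case: (leP b s) => ?; case: (leP b t) => ?; rewrite ?(max_r ab)//;
  case: (leP a s) => ?; case: (leP a t) => ?; split => //; lra.
Qed.

Lemma abs_cont_clamp (T : Type) (dist : T -> T -> R) (g : R -> T) (c e : R) :
  abs_cont_curve dist a b g -> abs_cont_curve dist c e (g \o clamp a b).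
Proof.
move=> acg eps /acg[del del0 acd]; exists del => // n u v uv duv sumuv.
apply: (acd n (clamp a b \o u) (clamp a b \o v)) => [i|i j /duv[]vu|] /=.
- have [_ [/clamp_le[? _] _]] := uv i; split; first by case/andP: (clamp_in (u i)).
  by split => //; case/andP: (clamp_in (v i)).
- by left; case: (clamp_le vu).
- by right; case: (clamp_le vu).
- apply: le_lt_trans sumuv; apply: ler_sum => i _.
  by have [_ [/clamp_le[_ ?] _]] := uv i.
Qed.

End clamp.

(** * The integrated causality estimate *)

Definition causal_at (R : realType) (X : Type) (d : X -> X -> R) (f : R -> R)
    (alpha : R -> R) (beta : R -> X) (t : R) : Prop :=
  derivable alpha t 1 /\ exists v, metric_deriv_at d beta t v /\
    - (derive1 alpha t) ^+ 2 + (f (alpha t)) ^+ 2 * v ^+ 2 <= 0.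

Lemma causal_atN (R : realType) (X : Type) (d : X -> X -> R) (f g : R -> R)
    (alpha : R -> R) (beta : R -> X) (t : R) : (forall x, g (- x) = f x) ->
  causal_at d f alpha beta t -> causal_at d g (fun x => - alpha x) beta t.
Proof.
move=> gf [dal [v [bv le]]]; split; first exact: derivableN.
exists v; split => //; rewrite gf derive1E.
by rewrite [X in X ^+ 2](_ : _ = - derive1 alpha t) ?sqrrN// deriveN// derive1E.
Qed.

(** Causality bounds the metric derivative by the absolute derivative of [alpha] divided by [m];
    [abs_cont_dist_le] integrates this with the monotone function [alpha x / m] as [H]. *)
Lemma causal_dist_le (R : realType) (X : Type) (d : X -> X -> R) (f : R -> R)
    (s t m : R) (alpha : R -> R) (beta : R -> X) :
  is_metric d -> s <= t -> 0 < m ->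
  abs_cont_curve d s t beta ->
  (forall x y, s <= x -> x <= y -> y <= t -> alpha x <= alpha y) ->
  (forall x, s <= x <= t -> m <= f (alpha x)) ->
  ae_on s t (causal_at d f alpha beta) ->
  d (beta s) (beta t) <= (alpha t - alpha s) / m.
Proof.
move=> dm st m0 acb nda mf aec; rewrite mulrBl.
apply: (@abs_cont_dist_le _ _ d beta (fun x => alpha x / m)) => //.
  by move=> x y sx xy yt; rewrite ler_pM2r ?invr_gt0//; exact: nda.
have Fae := ae_filter_ringOfSetsType (@lebesgue_measure R).
rewrite /ae_on in aec *; apply: filterS aec => x /= + xst => /(_ xst) [dal [v [bv le]]] e e0.
rewrite in_itv/= in xst; have {}mf := mf _ xst.
have e2 : 0 < e / 2 by rewrite divr_gt0.
have [eta1 eta10 A1] := derivable_eps dal (mulr_gt0 m0 e2).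
have [eta2 eta20 B2] := (metric_deriv_atP _ _ _ dm).1 bv _ e2.
exists (Num.min eta1 eta2); first by rewrite lt_min eta10.
move=> k; rewrite lt_min => /andP[/A1 {}A1 /B2 {}B2] _.
have mv : v <= `|derive1 alpha x| / m.
  rewrite ler_pdivlMr//; apply: (le_trans (ler_norm _)).
  rewrite -(@ler_pXn2r _ 2) ?nnegrE// !real_normK ?num_real// exprMn mulrC.
  apply: (@le_trans _ _ (f (alpha x) ^+ 2 * v ^+ 2)); last by lra.
  rewrite ler_wpM2r ?sqr_ge0// ler_pXn2r// nnegrE ltW//.
  exact: lt_le_trans mf.
have le1 : `|derive1 alpha x| * `|k| - m * (e / 2) * `|k| <= `|alpha (x + k) - alpha x|.
  rewrite lerBlDr -lerBlDl -normrM.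
  by apply: le_trans A1; rewrite [leRHS]distrC; exact: lerB_dist.
rewrite -mulrBl normrM (@gtr0_norm _ m^-1) ?invr_gt0//.
have le2 : `|derive1 alpha x| / m * `|k| - e / 2 * `|k| <= `|alpha (x + k) - alpha x| / m.
  rewrite ler_pdivlMr//; apply: le_trans le1; rewrite le_eqVlt.
  by apply/orP; left; apply/eqP; field; rewrite gt_eqF.
have le3 := ler_wpM2r (normr_ge0 k) mv.
by move: B2; rewrite ler_norml => /andP[_ ?]; lra.
Qed.

(** * Pointwise limits of curves with nondecreasing time component *)

Section increasing_limit.
Context (R : realType) (X : Type) (d : X -> X -> R) (O : set R) (f : R -> R)
  (a b : R) (alpha_ : nat -> R -> R) (beta_ : nat -> R -> X)
  (alpha : R -> R) (beta : R -> X).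
Hypothesis dmetric : is_metric d.
Hypothesis openO : open O.
Hypothesis itvO : is_interval O.
Hypothesis cf : forall x, O x -> {for x, continuous f}.
Hypothesis f0 : forall x, O x -> 0 < f x.
Hypothesis ab : a < b.
Hypothesis O_ : forall n t, a <= t <= b -> O (alpha_ n t).
Hypothesis Oal : forall t, a <= t <= b -> O (alpha t).
Hypothesis acb_ : forall n, abs_cont_curve d a b (beta_ n).
Hypothesis aca : abs_cont_curve (@real_dist R) a b alpha.
Hypothesis nd_ : forall n x y, a <= x -> x <= y -> y <= b ->
  alpha_ n x <= alpha_ n y.
Hypothesis causal_ : forall n, ae_on a b (causal_at d f (alpha_ n) (beta_ n)).
Hypothesis dal : ae_on a b (fun t => derivable alpha t 1 /\ derive1 alpha t != 0).
Hypothesis lim : forall t, a <= t <= b ->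
  (fun n => warped_dist d (alpha_ n t, beta_ n t) (alpha t, beta t)) @ \oo --> 0.

Let d0 x y : 0 <= d x y. Proof. by case: dmetric. Qed.

Let dC x y : d x y = d y x. Proof. by case: dmetric. Qed.
Let dT x y z : d x z <= d x y + d y z. Proof. by case: dmetric. Qed.

Let approx s t (e : R) : a <= s <= b -> a <= t <= b -> 0 < e -> exists n,
  [/\ `|alpha_ n s - alpha s| < e, d (beta_ n s) (beta s) < e,
      `|alpha_ n t - alpha t| < e & d (beta_ n t) (beta t) < e].
Proof.
move=> sab tab e0.
have near_t u : a <= u <= b -> \forall n \near \oo,
    `|alpha_ n u - alpha u| < e /\ d (beta_ n u) (beta u) < e.
  move=> uab; have /cvgrPdist_lt/(_ e e0) := lim uab.
  apply: filterS => n; rewrite sub0r normrN /warped_dist /= => /ltr_normlW.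
  by have := normr_ge0 (alpha_ n u - alpha u); have := d0 (beta_ n u) (beta u); split; lra.
have [n [[? ?] [? ?]]] := filter_ex (filterI (near_t s sab) (near_t t tab)).
by exists n.
Qed.

Let nda s t : a <= s -> s <= t -> t <= b -> alpha s <= alpha t.
Proof.
move=> as_ st tb; apply/ler_addgt0Pr => e e0.
have e2 : 0 < e / 2 by rewrite divr_gt0.
have [| |n [+ _ + _]] := @approx s t _ _ _ e2; [by rewrite as_ (le_trans st)|
  by rewrite tb (le_trans as_)|].
have := nd_ n as_ st tb.
by rewrite !ltr_norml => ? /andP[? ?] /andP[? ?]; lra.
Qed.

(** Monotonicity keeps [alpha_ n] on [[s, t]] between its endpoint values, eventually within [r] of
    those of [alpha]; convergence at [s] and [t] alone thus puts the whole arc where [m] bounds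
    [f]. *)
Let dist_le s t (r m : R) : a <= s -> s <= t -> t <= b -> 0 < r -> 0 < m ->
  (forall x, O x -> alpha s - r <= x <= alpha t + r -> m <= f x) ->
  d (beta s) (beta t) <= (alpha t - alpha s) / m.
Proof.
move=> as_ st tb r0 m0 mf; apply/ler_addgt0Pr => e e0.
have sab : a <= s <= b by rewrite as_ (le_trans st).
have tab : a <= t <= b by rewrite tb (le_trans as_).
(* The three bounds fit the range into the margin [r], control the two distance errors, and control
   the error of [alpha_ n] after division by [m]. *)
pose e' := Num.min r (Num.min (e / 4) (m * e / 4)).
have e'0 : 0 < e' by rewrite !lt_min r0 !divr_gt0// mulr_gt0.
have [n [as1 bs at1 bt]] := approx sab tab e'0.
have [e'r e'e e'm] : [/\ e' <= r, e' <= e / 4 & e' <= m * e / 4].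
  by split; rewrite !ge_min lexx ?orbT.
have dn : d (beta_ n s) (beta_ n t) <= (alpha_ n t - alpha_ n s) / m.
  apply: (causal_dist_le dmetric st m0 (abs_cont_curveS as_ tb (@acb_ n)) _ _
    (ae_onS as_ tb (@causal_ n))) => [x y sx xy yt|x /andP[sx xt]].
    by apply: nd_ => //; [exact: le_trans sx|exact: le_trans tb].
  apply: mf; first by apply: O_; rewrite (le_trans as_)// (le_trans xt).
  have := nd_ n as_ sx (le_trans xt tb); have := nd_ n (le_trans as_ sx) xt tb.
  by move: as1 at1; rewrite !ltr_norml => /andP[? ?] /andP[? ?]; lra.
have : (alpha_ n t - alpha_ n s) / m <= (alpha t - alpha s) / m + e / 2.
  rewrite ler_pdivrMr// mulrDl divfK ?gt_eqF//.
  by move: as1 at1; rewrite !ltr_norml => /andP[? ?] /andP[? ?]; lra.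
have := dT (beta s) (beta_ n s) (beta t); have := dT (beta_ n s) (beta_ n t) (beta t).
rewrite (dC (beta s) (beta_ n s)); lra.
Qed.

(** Since [alpha a] and [alpha b] are interior to the interval [O], a slightly larger compact
    interval still lies in [O], and [f] attains a positive minimum there. *)
Let uniform_bound : exists2 m : R, 0 < m & exists2 r : R, 0 < r &
  forall x, O x -> alpha a - r <= x <= alpha b + r -> m <= f x.
Proof.
have aab : a <= a <= b by rewrite lexx ltW.
have bab : a <= b <= b by rewrite lexx ltW.
have /nbhs_ballP[r1 /= r10 O1] : nbhs (alpha a) O by apply: open_nbhs_nbhs; split => //; exact: Oal.
have /nbhs_ballP[r2 /= r20 O2] : nbhs (alpha b) O by apply: open_nbhs_nbhs; split => //; exact: Oal.
pose r := Num.min r1 r2 / 2.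
have r0 : 0 < r by rewrite divr_gt0// lt_min r10.
have [rr1 rr2] : r < r1 /\ r < r2.
  have : Num.min r1 r2 <= r1 by rewrite ge_min lexx.
  have : Num.min r1 r2 <= r2 by rewrite ge_min lexx orbT.
  by move: r0; rewrite /r => ? ? ?; split; lra.
have Or x : alpha a - r <= x <= alpha b + r -> O x.
  apply: itvO; first by apply: O1; rewrite /ball/= opprB addrC subrK gtr0_norm.
  by apply: O2; rewrite /ball/= opprD addNKr normrN gtr0_norm.
have [||c cin cmin] := @EVT_min R f (alpha a - r) (alpha b + r).
- by have := nda (lexx a) (ltW ab) (lexx b); lra.
- apply: continuous_in_subspaceT => x; rewrite inE/= in_itv/= => xr.
  by apply: cf; exact: Or.
exists (f c); first by apply: f0; apply: Or; rewrite in_itv in cin.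
by exists r => // x _ xr; apply: cmin; rewrite in_itv.
Qed.

(** If [alpha s = alpha t], monotonicity makes [alpha] constant on [[s, t]], so its derivative
    vanishes at a point where it is assumed nonzero. *)
Lemma limit_increasing s t : a <= s -> s < t -> t <= b -> alpha s < alpha t.
Proof.
move=> as_ st tb; rewrite lt_neqAle nda// ?andbT ?ltW//; apply/eqP => ast.
have [N nN NP] := ae_onP dal.
have [x /andP[sx xt] Nx] := negligible_itv_exists nN st.
have [|dx] := NP x _ Nx; first by apply/andP; split; lra.
apply/negP/negPn; rewrite -normr_le0; apply/ler_addgt0Pr => e e0; rewrite add0r.
have [eta eta0 A] := derivable_eps dx e0.
pose h := Num.min (eta / 2) (t - x).
have h0 : 0 < h by rewrite lt_min divr_gt0// subr_gt0.
have [h1 h2] : h <= eta / 2 /\ h <= t - x by split; rewrite ge_min lexx ?orbT.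
have := A h; rewrite (gtr0_norm h0) => /(_ _).
have -> : alpha (x + h) = alpha x.
  have u1 : alpha s <= alpha x by apply: nda; lra.
  have u2 : alpha x <= alpha (x + h) by apply: nda; lra.
  have u3 : alpha (x + h) <= alpha t by apply: nda; lra.
  lra.
rewrite subrr sub0r normrN normrM (gtr0_norm h0) ler_pM2r//; apply; lra.
Qed.

(** The uniform bound [m] yields existence of the metric derivative; the sharp inequality then comes
    from lower bounds of [f] close to [f (alpha x)] on short arcs starting at [x]. *)
Lemma limit_causal_ae : ae_on a b (causal_at d f alpha beta).
Proof.
have [m m0 [r r0 mf]] := uniform_bound.
pose c := clamp a b; have cin t := clamp_in (ltW ab) t.
pose G t := alpha (c t) / m.
have ndG : {homo G : x y / x <= y}.
  move=> x y xy; rewrite ler_pM2r ?invr_gt0//.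
  have /andP[? _] := cin x; have /andP[_ ?] := cin y.
  by have [? _] := clamp_le (ltW ab) xy; exact: nda.
have acG u v : abs_cont_curve (@real_dist R) u v G.
  apply: (@abs_cont_curve_dominated _ _ _ (@real_dist R) _ (alpha \o c) _ m^-1).
  - by rewrite invr_ge0 ltW.
  - move=> s t _ _ _; rewrite /real_dist /G /= -mulrBl normrM mulrC.
    by rewrite (@gtr0_norm _ m^-1) ?invr_gt0.
  - by apply: abs_cont_clamp => //; exact: ltW.
have bdG : exists B, forall x, `|G x| <= B.
  exists (`|G a| + `|G b|) => x; rewrite ler_norml.
  have := ler_norm (G b); have := lerNnormlW (lexx `|G a|).
  have /andP[x1 x2] := cin x.
  have : G a <= G x.
    rewrite /G ler_pM2r ?invr_gt0// /c (@clamp_id _ _ _ a) ?lexx ?(ltW ab)//; by apply: nda.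
  have : G x <= G b.
    rewrite /G ler_pM2r ?invr_gt0// /c (@clamp_id _ _ _ b) ?lexx ?(ltW ab)//; by apply: nda.
  have := normr_ge0 (G a); have := normr_ge0 (G b).
  by move=> *; apply/andP; split; lra.
have [B GB] := bdG.
have betaG s t : s <= t -> d ((beta \o c) s) ((beta \o c) t) <= G t - G s.
  move=> st; rewrite /G -mulrBl /=.
  have /andP[a1 b1] := cin s; have /andP[a2 b2] := cin t.
  have [st' _] := clamp_le (ltW ab) st.
  apply: (dist_le a1 st' b2 r0 m0) => x Ox /andP[x1 x2]; apply: mf => //.
  have := nda (lexx a) a1 b1; have := nda a2 b2 (lexx b); rewrite -/c => ? ?.
  by apply/andP; split; lra.
have := metric_deriv_ae dmetric ndG acG GB betaG a.
have Fae := ae_filter_ringOfSetsType (@lebesgue_measure R).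
(* The clamped curve agrees with [beta] on a neighbourhood of interior points only, so the endpoints
   are discarded. *)
have nb : {ae lebesgue_measure, forall x : R, x != a /\ x != b}.
  have null_point y : (@lebesgue_measure R).-negligible [set y].
    by exists [set y]; split => //; exact: lebesgue_measure_set1.
  apply: negligibleS (negligibleU (null_point a) (null_point b)).
  by move=> x /= /not_andP[]/negP/negPn/eqP; [left|right].
have dal2 := dal; rewrite /ae_on in dal2 *; apply: filterS3 nb dal2 => x [xa xb] + + xab.
move: (xab); rewrite /= in_itv/= => /andP[ax xb'] /(_ xab)[dx dx0].
have {}ax : a < x by rewrite lt_neqAle eq_sym xa.
have {}xb : x < b by rewrite lt_neqAle xb.
move=> /(_ ax)[v bv].
have {}bv : metric_deriv_at d beta x v.
  apply/(metric_deriv_atP _ _ _ dmetric) => e e0.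
  have [eta eta0 bev] := (metric_deriv_atP _ _ _ dmetric).1 bv e e0.
  exists (Num.min eta (Num.min (x - a) (b - x))); first by rewrite !lt_min eta0 !subr_gt0 ax.
  move=> h; rewrite !lt_min => /andP[/bev + /andP[]]; rewrite !ltr_norml /= /c.
  by move=> + /andP[? ?] /andP[? ?]; rewrite !clamp_id//; apply/andP; split; lra.
split => //; exists v; split => //.
have fx0 : 0 < f (alpha x) by apply: f0; apply: Oal; rewrite !ltW.
have v0 : 0 <= v.
  apply/ler_addgt0Pr => e e0.
  have [eta eta0 bev] := (metric_deriv_atP _ _ _ dmetric).1 bv e e0.
  have h0 : 0 < eta / 2 by rewrite divr_gt0.
  have := bev (eta / 2); rewrite (gtr0_norm h0) => /(_ _)/ler_normlW.
  have := d0 (beta (x + eta / 2)) (beta x) => ? H.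
  rewrite -(ler_pM2r h0) mul0r mulrDl.
  apply: le_trans (_ : d (beta (x + eta / 2)) (beta x) <= _) => //.
  by rewrite -lerBlDl; apply: H; lra.
(* As [v] and [f (alpha x)] are nonnegative, squaring this yields the causal inequality. *)
suff fv : f (alpha x) * v <= derive1 alpha x.
  rewrite addrC subr_le0 -exprMn ler_pXn2r// nnegrE; first by rewrite mulr_ge0// ltW.
  by apply: le_trans fv; rewrite mulr_ge0// ltW.
apply/ler_addgt0Pr => e e0.
set A := f (alpha x) in fx0 *.
have D0 : 0 < 1 + v + A by lra.
(* [A / 2] keeps [A - e'] positive; the other bound absorbs the error [(1 + v + A) * e'] that
   appears when [le3] is expanded. *)
pose e' := Num.min (A / 2) (e / (1 + v + A)).
have e'0 : 0 < e' by rewrite lt_min !divr_gt0.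
have [e'A e'e] : e' <= A / 2 /\ (1 + v + A) * e' <= e.
  split; first by rewrite ge_min lexx.
  by rewrite mulrC -ler_pdivlMr// ge_min lexx orbT.
have : {for alpha x, continuous f} by apply: cf; apply: Oal; rewrite !ltW.
move=> /cvgrPdist_lt/(_ e' e'0)/nbhs_ballP[rho /= rho0 frho].
have [eta1 eta10 A1] := derivable_eps dx e'0.
have [eta2 eta20 B1] := (metric_deriv_atP _ _ _ dmetric).1 bv _ e'0.
(* [q] bounds the growth rate of [alpha] just after [x]; with [q * h < rho / 2] and the margin
   [rho / 2] in [dist_le], all relevant values lie in the ball of radius [rho], where [f] exceeds
   [A - e']. *)
pose q := `|derive1 alpha x| + e'.
have q0 : 0 < q by rewrite ltr_wpDl.
pose h := Num.min (Num.min eta1 eta2) (Num.min (b - x) (rho / q / 2)) / 2.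
have H0 : 0 < Num.min (Num.min eta1 eta2) (Num.min (b - x) (rho / q / 2)).
  by rewrite !lt_min eta10 eta20 subr_gt0 xb !divr_gt0.
have h0 : 0 < h by rewrite divr_gt0.
have : h < Num.min (Num.min eta1 eta2) (Num.min (b - x) (rho / q / 2)).
  by rewrite /h ltr_pdivrMr// ltr_pMr// ltr1n.
rewrite !lt_min => /andP[/andP[h1 h2] /andP[hb hrho]].
have hh : `|h| = h by rewrite gtr0_norm.
have := A1 h; rewrite hh => /(_ h1); rewrite ler_norml => /andP[_ A1h].
have := B1 h; rewrite hh => /(_ h2); rewrite ler_norml => /andP[B1h _].
have qh : q * h < rho / 2.
  by rewrite mulrC -ltr_pdivlMr// mulrAC.
have Dh : derive1 alpha x * h <= `|derive1 alpha x| * h.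
  by rewrite ler_pM2r// ler_norm.
have Axh : alpha (x + h) - alpha x <= q * h by rewrite /q mulrDl; lra.
have Ae : 0 < A - e' by lra.
have := @dist_le x (x + h) (rho / 2) (A - e').
rewrite divr_gt0// (ltW ax) lerDl (ltW h0) => /(_ isT isT _ isT Ae) H1.
have xhb : x + h <= b by lra.
have le1 : d (beta x) (beta (x + h)) <= (alpha (x + h) - alpha x) / (A - e').
  apply: H1 => // y Oy /andP[y1 y2].
  have := nda (ltW ax) (_ : x <= x + h) xhb; rewrite lerDl (ltW h0) => /(_ isT) ?.
  have := frho y; rewrite /ball/= ltr_norml => /(_ _)/ltr_normlW fy.
  by rewrite -/A in fy; have : A - f y < e' by [apply: fy; apply/andP; split; lra]; lra.
rewrite dC ler_pdivlMr// in le1.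
have le2 : (v - e') * h * (A - e') <= derive1 alpha x * h + e' * h.
  apply: le_trans (_ : d (beta (x + h)) (beta x) * (A - e') <= _); last by lra.
  by rewrite ler_pM2r//; lra.
have le3 : (v - e') * (A - e') <= derive1 alpha x + e'.
  rewrite -(ler_pM2r h0); lra.
nra.
Qed.
End increasing_limit.

(** * Open intervals, time orientation and time reversal *)

Lemma open_itv_open (R : realType) (l u : \bar R) : open (open_itv l u).
Proof.
rewrite (_ : open_itv l u =
  [set t | (l < t%:E)%E] `&` [set t | (t%:E < u)%E])//.
apply: openI.
- case: l => [r| |]; last 2 first.
  + by rewrite (_ : [set _ | _] = set0); [exact: open0|apply/seteqP; split => // t /=; rewrite ltNge leey].
  + by rewrite (_ : [set _ | _] = setT); [exact: openT|apply/seteqP; split => // t _ /=; rewrite ltNyr].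
  by rewrite (_ : [set _ | _] = [set t | r < t])//; exact: open_gt.
- case: u => [r| |]; last 2 first.
  + by rewrite (_ : [set _ | _] = setT); [exact: openT|apply/seteqP; split => // t _ /=; rewrite ltry].
  + by rewrite (_ : [set _ | _] = set0); [exact: open0|apply/seteqP; split => // t /=; rewrite ltNge leNye].
  by rewrite (_ : [set _ | _] = [set t | t < r])//; exact: open_lt.
Qed.

Lemma open_itv_is_interval (R : realType) (l u : \bar R) :
  is_interval (open_itv l u).
Proof.
move=> x y [lx _] [_ yu] z /andP[xz zy]; split.
- by apply: lt_le_trans lx _; rewrite lee_fin.
- by apply: le_lt_trans yu; rewrite lee_fin.
Qed.

Lemma decreasing_derive1_le0 (R : realType) (F : R -> R) (a b x : R) :
  (forall s t, a <= s -> s < t -> t <= b -> F t < F s) -> a <= x < b ->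
  derivable F x 1 -> derive1 F x <= 0.
Proof.
move=> decF /andP[ax xb] dF; rewrite leNgt; apply/negP => D0.
have [eta eta0 FD] := derivable_eps dF D0.
pose h := Num.min (eta / 2) (b - x).
have h0 : 0 < h by rewrite lt_min divr_gt0// subr_gt0.
have [h1 h2] : h <= eta / 2 /\ h <= b - x by split; rewrite ge_min lexx ?orbT.
have := FD h; rewrite (gtr0_norm h0) ler_norml => /(_ _)/andP[|H _]; first lra.
have := decF x (x + h) ax; rewrite ltrDl h0 => /(_ isT _); lra.
Qed.

(** A strictly decreasing [alpha] would have derivative at most [0], against the positive derivative
    at some point of any subinterval. *)
Lemma future_directed_nondecreasing (R : realType) (X : Type)
    (d : X -> X -> R) (f : R -> R) (a b : R) (alpha : R -> R) (beta : R -> X) :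
  future_directed_causal d f a b alpha beta ->
  forall x y, a <= x -> x <= y -> y <= b -> alpha x <= alpha y.
Proof.
move=> [[_ [incr|decr] _] pos] x y ax; rewrite le_eqVlt => /predU1P[->//|xy] yb.
  exact/ltW/incr.
have [N nN NP] := ae_onP pos.
have [z /andP[xz zy] Nz] := negligible_itv_exists nN xy.
have [|dz Dz] := NP z _ Nz; first by apply/andP; split; lra.
have zab : a <= z < b by apply/andP; split; lra.
by have := decreasing_derive1_le0 decr zab dz; rewrite leNgt Dz.
Qed.

(** Negating [alpha] swaps the orientation, and composing [f] with negation keeps the warping factor
    along the curve. *)
Lemma future_directedN (R : realType) (X : Type)
    (d : X -> X -> R) (f : R -> R) (a b : R) (alpha : R -> R) (beta : R -> X) :
  past_directed_causal d f a b alpha beta ->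
  future_directed_causal d (f \o -%R) a b (fun t => - alpha t) beta.
Proof.
have Fae := ae_filter_ringOfSetsType (@lebesgue_measure R).
move=> [[ac mono c] neg]; split; first split.
- apply: (@abs_cont_curve_dominated _ _ _ (warped_dist d) (warped_dist d) (fun t => (alpha t, beta t)) _ 1) => // s t _ _ _.
  by rewrite mul1r /warped_dist /= -opprD normrN.
- case: mono => H; [right|left] => s t as_ st tb; rewrite ltrN2; exact: H.
- rewrite /ae_on in c *; apply: filterS c => t + tab => /(_ tab).
  by apply: causal_atN => x /=; rewrite opprK.
- rewrite /ae_on in neg *; apply: filterS neg => t + tab => /(_ tab)[dal dneg].
  split; first exact: derivableN.
  by rewrite derive1E deriveN// -derive1E oppr_gt0.
Qed.

(** Continuity within the open interval becomes ordinary continuity, and domination by [warped_dist]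
    gives absolute continuity of each [beta_ n] and of [alpha], as the limit argument requires. *)
Lemma increasing_limit_causal (R : realType) (X : Type) (d : X -> X -> R)
    (l u : \bar R) (f : R -> R) (a b : R)
    (alpha_ : nat -> R -> R) (beta_ : nat -> R -> X)
    (alpha : R -> R) (beta : R -> X) :
  a < b ->
  is_metric d ->
  {within open_itv l u, continuous f} ->
  (forall t, open_itv l u t -> 0 < f t) ->
  (forall n t, a <= t <= b -> open_itv l u (alpha_ n t)) ->
  (forall t, a <= t <= b -> open_itv l u (alpha t)) ->
  abs_cont_curve (warped_dist d) a b (fun t => (alpha t, beta t)) ->
  (forall n, future_directed_causal d f a b (alpha_ n) (beta_ n)) ->
  ae_on a b (fun t => derivable alpha t 1 /\ derive1 alpha t != 0) ->
  (forall t, a <= t <= b ->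
     (fun n => warped_dist d (alpha_ n t, beta_ n t) (alpha t, beta t))
       @ \oo --> 0) ->
  (forall s t, a <= s -> s < t -> t <= b -> alpha s < alpha t) /\
  ae_on a b (causal_at d f alpha beta).
Proof.
move=> ab dm cf f0 O_ Oal ac fut dal lim.
have [d0 _ _ _] := dm.
have oO : open (open_itv l u) by exact: open_itv_open.
have iO := @open_itv_is_interval R l u.
have cf' x : open_itv l u x -> {for x, continuous f}.
  by rewrite (continuous_open_subspace f oO) in cf => Ox; apply: cf; rewrite inE.
have acb_ n : abs_cont_curve d a b (beta_ n).
  have [[acn _ _] _] := fut n.
  apply: (abs_cont_curve_dominated ler01) acn => s t _ _ _.
  by rewrite mul1r /warped_dist lerDr.
have aca : abs_cont_curve (@real_dist R) a b alpha.
  apply: (abs_cont_curve_dominated ler01) ac => s t _ _ _.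
  by rewrite mul1r /warped_dist lerDl.
have nd_ n := future_directed_nondecreasing (fut n).
have c_ n : ae_on a b (causal_at d f (alpha_ n) (beta_ n)) by have [[]] := fut n.
split.
- by move=> s t; exact: (limit_increasing dm nd_ dal lim).
- exact: limit_causal_ae dm oO iO cf' f0 ab O_ Oal acb_ aca nd_ c_ dal lim.
Qed.

Theorem theorem3p16 (R : realType) (X : Type) (d : X -> X -> R)
    (l u : \bar R) (f : R -> R) (a b : R)
    (alpha_ : nat -> R -> R) (beta_ : nat -> R -> X)
    (alpha : R -> R) (beta : R -> X) :
  is_metric d ->
  {within open_itv l u, continuous f} ->
  (forall t, open_itv l u t -> 0 < f t) ->
  (forall n t, a <= t <= b -> open_itv l u (alpha_ n t)) ->
  (forall t, a <= t <= b -> open_itv l u (alpha t)) ->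
  (forall n, abs_cont_curve (warped_dist d) a b
                (fun t => (alpha_ n t, beta_ n t))) ->
  abs_cont_curve (warped_dist d) a b (fun t => (alpha t, beta t)) ->
  ((forall n, future_directed_causal d f a b (alpha_ n) (beta_ n)) \/
   (forall n, past_directed_causal d f a b (alpha_ n) (beta_ n))) ->
  ae_on a b (fun t => derivable alpha t 1 /\ derive1 alpha t != 0) ->
  (forall t, a <= t <= b ->
     (fun n => warped_dist d (alpha_ n t, beta_ n t) (alpha t, beta t))
       @ \oo --> 0) ->
  causal d f a b alpha beta.
Proof.
move=> dm cf f0 O_ Oal ac_ ac dir dal lim.
have Fae := ae_filter_ringOfSetsType (@lebesgue_measure R).
(* If [b <= a] the domain has at most one point: monotonicity is vacuous and the singleton of [a] is
   the exceptional null set. *)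
have [ba|ab] := leP b a.
  split => //; first by left => s t *; lra.
  exists [set a]; split => //; first exact: lebesgue_measure_set1.
  move=> x /= /not_implyP[]; rewrite in_itv/= => /andP[? ?] _; lra.
case: dir => dir.
  have [inc cau] := increasing_limit_causal ab dm cf f0 O_ Oal ac dir dal lim.
  by split => //; left.
have opp_open t : open_itv (- u)%E (- l)%E t -> open_itv l u (- t).
  by move=> [ut tl]; split; rewrite EFinN; [rewrite lteNr|rewrite lteNl].
have open_opp t : open_itv l u t -> open_itv (- u)%E (- l)%E (- t).
  by move=> [lt_ tu]; split; rewrite EFinN lteN2.
(* The past directed case is reflected to [- alpha] on the interval from [- u] to [- l], with
   warping function [f \o -%R]. *)
have [||||||||inc cau] := @increasing_limit_causal R X d (- u)%E (- l)%E (f \o -%R) a b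
  (fun n t => - alpha_ n t) beta_ (fun t => - alpha t) beta ab dm.
- have oO : open (open_itv l u) by exact: open_itv_open.
  have oN : open (open_itv (- u)%E (- l)%E) by exact: open_itv_open.
  rewrite (continuous_open_subspace f oO) in cf.
  rewrite (continuous_open_subspace _ oN) => x; rewrite inE => Ox.
  apply: continuous_comp; first exact: opp_continuous.
  by apply: cf; rewrite inE; exact: opp_open.
- by move=> t Ot; apply/f0/opp_open.
- by move=> n t tab; apply/open_opp/O_.
- by move=> t tab; apply/open_opp/Oal.
- apply: (abs_cont_curve_dominated ler01) ac => s t _ _ _.
  by rewrite mul1r /warped_dist /= -opprD normrN.
- by move=> n; apply: future_directedN.
- rewrite /ae_on in dal *; apply: filterS dal => t + tab => /(_ tab)[dt Dt].
  split; first exact: derivableN.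
  by rewrite derive1E deriveN// -derive1E oppr_eq0.
- move=> t tab; have := lim t tab; apply: cvg_trans; apply: near_eq_cvg.
  by near=> n; rewrite /warped_dist /= -opprD normrN.
split => //.
- by right => s t as_ st tb; rewrite -ltrN2; exact: inc.
- rewrite /ae_on in cau *; apply: filterS cau => t + tab => /(_ tab).
  move=> /(@causal_atN R X d (f \o -%R) f _ beta t (fun=> erefl)) /=.
  by rewrite (_ : (fun x => - - alpha x) = alpha)//; apply/funext => x; rewrite opprK.
Unshelve. all: by end_near.
Qed.
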